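(* The order $(\mathsf{ConnGraph},\leq^{LI})$ of finite connected graphs under locally injective homomorphisms is universal.
   Context: $\mathsf{ConnGraph}$ is the class of all finite connected undirected graphs (loops allowed), considered up to isomorphism. $N_G(v)$ is the set of vertices adjacent to $v$. A graph homomorphism $f:G\to H$ is locally injective if for every $v\in V_G$ the restriction of $f$ to $N_G(v)\to N_H(f(v))$ is injective. $G\leq^{LI}H$ means there is a locally injective homomorphism $G\to H$; on isomorphism classes of finite connected graphs this is a partial order. A countable partial order is universal if every countable partial order $(P,\leq_P)$ embeds into it, i.e. there is a map $E$ with $a\leq_P b\iff E(a)\leq E(b)$ for all $a,b\in P$. *)

(* Defs.v *)
From HB Require Import structures.
From mathcomp Require Import all_boot all_order generic_quotient.
From mathcomp Require Import boolp classical_sets cardinality.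

Set Implicit Arguments.
Unset Strict Implicit.
Unset Printing Implicit Defensive.

Import Order.TTheory.

(* An undirected graph on the vertex set T is a symmetric relation e : rel T;
   e is not required to be irreflexive, so loops are allowed (and a looped
   vertex belongs to its own neighbourhood). *)

Definition neighbours (T : finType) (e : rel T) (v : T) : {set T} :=
  [set w | e v w]%SET.

Definition graph_hom (T U : finType) (e : rel T) (e' : rel U) (f : T -> U) :=
  forall x y, e x y -> e' (f x) (f y).

Definition locally_injective (T U : finType) (e : rel T) (f : T -> U) :=
  forall v, {in neighbours e v &, injective f}.

Definition li_hom (T U : finType) (e : rel T) (e' : rel U) (f : T -> U) :=
  graph_hom e e' f /\ locally_injective e f.

Definition graph_iso (T U : finType) (e : rel T) (e' : rel U) (f : T -> U) :=
  bijective f /\ forall x y, e' (f x) (f y) = e x y.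

Definition connected_graph (T : finType) (e : rel T) : Prop :=
  [/\ (0 < #|T|)%N, symmetric e & forall x y, connect e x y].

(* Every finite graph is isomorphic to one whose vertex set is some 'I_n, so
   isomorphism classes are built from graphs on the 'I_n; see class_exists. *)

Definition ord_rel := {n : nat & {set 'I_n * 'I_n}}.

Definition ord_edge (G : ord_rel) : rel 'I_(tag G) :=
  fun x y => (x, y) \in tagged G.
Arguments ord_edge : clear implicits.

Record cgraph := CGraph {
  cgraph_val :> ord_rel;
  cgraph_prop : `[< connected_graph (ord_edge cgraph_val) >] }.

HB.instance Definition _ := [isSub for cgraph_val].
HB.instance Definition _ := [Countable of cgraph by <:].

Definition vertex (G : cgraph) : finType := 'I_(tag (cgraph_val G)).
Definition edge (G : cgraph) : rel (vertex G) := ord_edge G.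
Arguments edge : clear implicits.

Lemma cgraphP (G : cgraph) : connected_graph (edge G).
Proof. by case: G => G p; apply/asboolP. Qed.

Definition isomorphic (G H : cgraph) : bool :=
  `[< exists f : vertex G -> vertex H, graph_iso (edge G) (edge H) f >].

Definition li_le (G H : cgraph) : bool :=
  `[< exists f : vertex G -> vertex H, li_hom (edge G) (edge H) f >].

Lemma isomorphic_refl : reflexive isomorphic.
Proof. by move=> G; apply/asboolP; exists id; split=> //; exists id. Qed.

Lemma isomorphic_sym : symmetric isomorphic.
Proof.
suff H G K : isomorphic G K -> isomorphic K G.
  by move=> G K; apply/idP/idP; apply: H.
move=> /asboolP[f [[g fK gK] fe]]; apply/asboolP; exists g; split.
  by exists f.
by move=> x y; rewrite -fe !gK.
Qed.

Lemma isomorphic_trans : transitive isomorphic.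
Proof.
move=> K G H /asboolP[f [bf fe]] /asboolP[g [bg ge]].
apply/asboolP; exists (g \o f); split; first exact: bij_comp.
by move=> x y /=; rewrite ge fe.
Qed.

Canonical isomorphic_equiv :=
  EquivRel isomorphic isomorphic_refl isomorphic_sym isomorphic_trans.

Lemma li_hom_comp (T U W : finType) (e : rel T) (e' : rel U) (e'' : rel W)
    (f : T -> U) (g : U -> W) :
  li_hom e e' f -> li_hom e' e'' g -> li_hom e e'' (g \o f).
Proof.
move=> [fh fi] [gh gi]; split=> [x y exy|v x y]; first exact/gh/fh.
move=> xv yv /= gfxy; apply: (fi v) => //.
move: xv yv; rewrite !inE => xv yv.
by apply: (gi (f v)) gfxy; rewrite inE fh.
Qed.

Lemma li_le_refl : reflexive li_le.
Proof. by move=> G; apply/asboolP; exists id; split=> // v x y. Qed.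

Lemma li_le_trans : transitive li_le.
Proof.
move=> K G H /asboolP[f hf] /asboolP[g hg].
by apply/asboolP; exists (g \o f); apply: li_hom_comp hg.
Qed.

Lemma isomorphic_li_le (G H : cgraph) : isomorphic G H -> li_le G H.
Proof.
move=> /asboolP[f [bf fe]]; apply/asboolP; exists f; split.
  by move=> x y; rewrite fe.
by move=> v x y _ _; apply: bij_inj.
Qed.

Lemma li_hom_iter (T : finType) (e : rel T) (h : T -> T) n :
  li_hom e e h -> li_hom e e (iter n h).
Proof.
move=> hh; elim: n => [|n IHn]; first by split=> // v x y.
exact: (li_hom_comp IHn hh).
Qed.

(* A self-map of a finite set has an idempotent iterate; an idempotent
   locally injective endomorphism of a connected graph is the identity. *)
Lemma idempotent_iter (T : finType) (h : T -> T) :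
  exists2 k, (0 < k)%N & forall x, iter k h (iter k h x) = iter k h x.
Proof.
pose F (i : 'I_(#|{ffun T -> T}|).+1) := [ffun x => iter i h x] : {ffun T -> T}.
have /injectivePn[i0 [j0 ij0 Fij0]] : ~~ injectiveb F.
  by apply/negP => /injectiveP /leq_card; rewrite card_ord ltnn.
have [i [p p0 per]] : exists i, exists2 p, (0 < p)%N &
    forall x, iter (i + p) h x = iter i h x.
  have E x : iter i0 h x = iter j0 h x by move/ffunP/(_ x): Fij0; rewrite !ffunE.
  have := ij0; rewrite -val_eqE neq_ltn => /orP[lt_ij|lt_ij].
    exists (val i0), (j0 - i0)%N => [|x]; first by rewrite subn_gt0.
    by rewrite subnKC ?E // ltnW.
  exists (val j0), (i0 - j0)%N => [|x]; first by rewrite subn_gt0.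
  by rewrite subnKC ?E // ltnW.
have perm m q x : (i <= m)%N -> iter (m + q * p) h x = iter m h x.
  move=> im; elim: q => [|q IHq]; first by rewrite mul0n addn0.
  rewrite -IHq mulSn (addnC p) addnA -(subnK (leq_trans im (leq_addr (q * p) m))).
  by rewrite -addnA iterD per -iterD.
exists (i.+1 * p)%N => [|x]; first by rewrite muln_gt0.
by rewrite -iterD perm // (leq_trans (leqnSn i)) // leq_pmulr.
Qed.

Lemma li_endo_iter_id (T : finType) (e : rel T) (h : T -> T) :
  connected_graph e -> li_hom e e h -> exists2 k, (0 < k)%N & iter k h =1 id.
Proof.
move=> [T0 _ econn] hh; have [k k0 idem] := idempotent_iter h.
exists k => //; have := li_hom_iter k hh; move: idem.
move: (iter k h) => r idem [rh ri] x.
have /card_gt0P[v0 _] := T0.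
have /connectP[s es ->] := econn (r v0) x.
elim: s (r v0) (idem v0) es => [//|w s IHs] v rv /= /andP[evw es].
apply: IHs es; apply: (ri v); rewrite ?inE //.
by rewrite -rv rh.
Qed.

Lemma li_le_anti (G H : cgraph) : li_le G H -> li_le H G -> isomorphic G H.
Proof.
move=> /asboolP[f hf] /asboolP[g hg]; apply/asboolP; exists f.
have [[|k] // _ gfk] := li_endo_iter_id (cgraphP G) (li_hom_comp hf hg).
have [[|l] // _ fgl] := li_endo_iter_id (cgraphP H) (li_hom_comp hg hf).
have fK : cancel f (iter k (g \o f) \o g).
  by move=> x; rewrite -[RHS]gfk iterSr.
have gK : cancel g (iter l (f \o g) \o f).
  by move=> x; rewrite -[RHS]fgl iterSr.
have bf : bijective f.
  apply: inj_card_bij (can_inj fK) _.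
  exact: leq_card (can_inj gK).
split=> // x y; apply/idP/idP => [efxy|]; last exact: (proj1 hf).
have [+ _] := li_hom_comp hg (li_hom_iter k (li_hom_comp hf hg)).
by move=> /(_ _ _ efxy); rewrite !fK.
Qed.

Definition ConnGraph := {eq_quot isomorphic}%qT.
HB.instance Definition _ := EqQuotient.on ConnGraph.
HB.instance Definition _ := Choice.on ConnGraph.

(* The order on classes, read off on representatives; by class_le below it
   does not depend on their choice. *)
Definition le_LI (x y : ConnGraph) : bool := li_le (repr x) (repr y).

Lemma le_LI_refl : reflexive le_LI.
Proof. by move=> x; apply: li_le_refl. Qed.

Lemma le_LI_anti : antisymmetric le_LI.
Proof.
move=> x y /andP[xy yx]; rewrite -[x]reprK -[y]reprK.
by apply/eqmodP; apply: li_le_anti.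
Qed.

Lemma le_LI_trans : transitive le_LI.
Proof. by move=> y x z; apply: li_le_trans. Qed.

Fact LI_display : Order.disp_t. Proof. exact: Order.Disp tt tt. Qed.

HB.instance Definition _ := Order.Le_isPOrder.Build LI_display ConnGraph
  le_LI_refl le_LI_anti le_LI_trans.

Definition class (G : cgraph) : ConnGraph := \pi_ConnGraph%qT G.

Lemma class_eq (G H : cgraph) : (class G == class H) = isomorphic G H.
Proof. exact: eqquotE. Qed.

Lemma class_le (G H : cgraph) : (class G <= class H)%O = li_le G H.
Proof.
have rG K : isomorphic (repr (class K)) K.
  by rewrite -class_eq /class reprK.
have rG' K : isomorphic K (repr (class K)) by rewrite isomorphic_sym.
apply/idP/idP => le_GH.
  apply: li_le_trans (isomorphic_li_le (rG' G)) _.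
  exact: li_le_trans le_GH (isomorphic_li_le (rG H)).
apply: li_le_trans (isomorphic_li_le (rG G)) _.
exact: li_le_trans le_GH (isomorphic_li_le (rG' H)).
Qed.

Lemma class_exists (T : finType) (e : rel T) : connected_graph e ->
  exists (G : cgraph) (f : T -> vertex G), graph_iso e (edge G) f.
Proof.
move=> [T0 esym econn].
pose A := [set p : 'I_#|T| * 'I_#|T| | e (enum_val p.1) (enum_val p.2)]%SET.
pose G0 : ord_rel := Tagged (fun n => {set 'I_n * 'I_n}) A.
have eE (x y : T) : ord_edge G0 (enum_rank x) (enum_rank y) = e x y.
  by rewrite /ord_edge inE !enum_rankK.
have eE' (i j : 'I_#|T|) : ord_edge G0 i j = e (enum_val i) (enum_val j).
  by rewrite /ord_edge inE.
have G0P : `[< connected_graph (ord_edge G0) >].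
  apply/asboolP; split=> [|i j|i j]; first by rewrite card_ord.
    by rewrite !eE' esym.
  have /connectP[s es js] := econn (enum_val i) (enum_val j).
  apply/connectP; exists (map enum_rank s).
    rewrite -[i in path _ i]enum_valK path_map.
    by rewrite (eq_path (e' := e)) //= => x y; apply: eE.
  by rewrite -[i in last i]enum_valK last_map -js enum_valK.
exists (CGraph G0P), enum_rank; split; last exact: eE.
exact: enum_rank_bij.
Qed.

Definition order_embedding d (P : porderType d) d' (Q : porderType d')
    (E : P -> Q) : Prop :=
  forall a b : P, (a <= b)%O <-> (E a <= E b)%O.

Definition universal d (Q : porderType d) : Prop :=
  countable [set: Q]%classic /\
  forall d' (P : porderType d'), countable [set: P]%classic ->
    exists E : P -> Q, order_embedding E.

(* Main.v *)
(* Let r be a partial order on the natural numbers. By recursion on n, a graph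
   G_n is built around a cycle of length g_n = p_n * prod_(j < n, r n j) p_j, with
   distinct primes p_j, so that g_m | g_n forces r n m. All vertices of the cycle
   carry loops and no other vertex does. To the cycle are attached a complete
   graph on four vertices and, for every i < n with r i n, a copy of G_i at the
   end of a long path.
   A locally injective map G_a -> G_b sends the looped cycle of G_a to a closed
   non-backtracking walk on a looped cycle of G_b, of length g_m with r m b; hence
   g_m | g_a, so r a m and r a b. Conversely, suppose r a b. If a < b, then G_a is
   a part of G_b. If b < a, wrap the cycle of G_a around that of G_b, map the copy
   of each G_i by recursion, and send the connecting paths, which are much longer
   than those of G_b, to non-backtracking walks that turn round in the complete
   graph of G_b. *)
Require Import Defs.
From mathcomp Require Import all_boot all_order all_algebra.
From mathcomp Require Import boolp classical_sets cardinality.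
From mathcomp Require Import zify ring.

Set Implicit Arguments.
Unset Strict Implicit.
Unset Printing Implicit Defensive.

Import Order.TTheory GRing.Theory.

(** * Locally injective homomorphisms and non-backtracking walks *)

Lemma li_hom_inj (T U : finType) (e : rel T) (e' : rel U) (f : T -> U) x y z :
  li_hom e e' f -> e x y -> e x z -> f y = f z -> y = z.
Proof. by move=> [_ fi] xy xz; apply: (fi x); rewrite inE. Qed.

Lemma li_hom_of_inj (T U : finType) (e : rel T) (e' : rel U) (f : T -> U) :
  (forall x y, e x y -> e' (f x) (f y)) ->
  (forall x y z, e x y -> e x z -> f y = f z -> y = z) -> li_hom e e' f.
Proof.
by move=> fh fi; split=> // x y z; rewrite !inE; apply: fi.
Qed.

Lemma hom_connect (T U : finType) (e : rel T) (e' : rel U) (f : T -> U) x y :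
  graph_hom e e' f -> connect e x y -> connect e' (f x) (f y).
Proof.
move=> fh /connectP[s es ->]; elim: s x es => //= z s IHs x /andP[xz /IHs].
by apply: connect_trans; apply/connect1/fh.
Qed.

(* [nbwalk e n x y u v]: a non-backtracking walk whose first edge is (x, y) and
   whose last edge, reached after n further steps, is (u, v). *)
Inductive nbwalk (T : eqType) (e : rel T) : nat -> T -> T -> T -> T -> Prop :=
| Nbwalk0 x y : e x y -> nbwalk e 0 x y x y
| NbwalkS n x y z u v :
    e x y -> x != z -> nbwalk e n y z u v -> nbwalk e n.+1 x y u v.

Lemma nbwalk_trans (T : eqType) (e : rel T) m n x y u v x' y' :
  nbwalk e m x y u v -> nbwalk e n u v x' y' -> nbwalk e (m + n) x y x' y'.
Proof. by elim=> // {}m {}x {}y z {}u {}v xy xz _ IH /IH; apply: NbwalkS. Qed.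

(** In a stretch [x, y, z] of the walk, [x] and [z] are distinct neighbours of [y], so local
    injectivity at [y] keeps their images distinct. *)
Lemma nbwalk_hom (T U : finType) (e : rel T) (e' : rel U) (f : T -> U)
    n x y u v : symmetric e -> li_hom e e' f ->
  nbwalk e n x y u v -> nbwalk e' n (f x) (f y) (f u) (f v).
Proof.
move=> es hf; elim=> [{}x {}y /hf.1|{}n {}x {}y z {}u {}v xy xz w IH].
  exact: Nbwalk0.
apply: NbwalkS (hf.1 _ _ xy) _ IH; apply: contra_neq xz.
apply: (li_hom_inj (x := y) hf); first by rewrite es.
by case: w.
Qed.

Lemma nbwalkP (T : eqType) (e : rel T) n x y u v : nbwalk e n x y u v ->
  exists g : nat -> T, [/\ [/\ g 0 = x, g 1 = y, g n = u & g n.+1 = v],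
    forall k, k <= n -> e (g k) (g k.+1) & forall k, k < n -> g k != g k.+2].
Proof.
elim=> [{}x {}y xy|{}n {}x {}y z {}u {}v xy xz w [g [[g0 g1 gn gn1] ge gnb]]].
  by exists (fun k => if k is 0 then x else y); split=> // -[].
exists (fun k => if k is k'.+1 then g k' else x); split=> //.
  by case=> [_|k]; rewrite ?g0 //; apply: ge.
by case=> [_|k]; rewrite ?g1 //; apply: gnb.
Qed.

(** * Hanging graphs on a core by long paths *)

Record pgraph := PGraph { vert : finType; adj : rel vert; port : vert }.
Arguments adj : clear implicits.
Arguments port : clear implicits.

Section Glue.

Variables (K : finType) (eK : rel K) (I : finType) (c : I -> pgraph).
Variables (pos : I -> K) (L : nat).

(** A limb is the child [c i] followed by a path of [L.+1] vertices: [ord0] meets the port of the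
    child and [ord_max] meets the core at [pos i]. *)
Definition limb (i : I) : finType := (vert (c i) + 'I_L.+1)%type.

Definition limb_edge (i : I) (x y : limb i) : bool :=
  match x, y with
  | inl u, inl v => adj (c i) u v
  | inl u, inr k | inr k, inl u => (u == port (c i)) && (k == ord0)
  | inr j, inr k => (k == j.+1 :> nat) || (j == k.+1 :> nat)
  end.

Definition glue : finType := (K + {i : I & limb i})%type.

Definition vlimb (i : I) (x : limb i) : glue := inr (Tagged limb x).
Definition vchild (i : I) (u : vert (c i)) : glue := vlimb (inl u : limb i).
Definition vpath (i : I) (k : 'I_L.+1) : glue := vlimb (inr k : limb i).

Definition limb_end (p : {i : I & limb i}) (x : K) : bool :=
  (x == pos (tag p)) && (if tagged p is inr k then k == ord_max else false).

Definition glue_edge : rel glue := fun a b =>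
  match a, b with
  | inl x, inl y => eK x y
  | inl x, inr p | inr p, inl x => limb_end p x
  | inr p, inr q => (tag p == tag q) && limb_edge (tagged p) (tagged_as p q)
  end.

Lemma glue_edge_limb i (x y : limb i) :
  glue_edge (vlimb x) (vlimb y) = limb_edge x y.
Proof. by rewrite /= eqxx tagged_asE. Qed.

Lemma vpath_unlooped i k : glue_edge (vpath i k) (vpath i k) = false.
Proof. by rewrite glue_edge_limb /= orbb ltn_eqF. Qed.

Lemma glueP (P : glue -> Prop) :
  (forall x, P (inl x)) -> (forall i u, P (@vchild i u)) ->
  (forall i k, P (vpath i k)) -> forall a, P a.
Proof.
by move=> Px Pc Pp [x|[i [u|k]]]; [apply: Px | apply: Pc | apply: Pp].
Qed.

Lemma glue_edge_core x b : glue_edge (inl x) b ->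
  (exists2 y, b = inl y & eK x y) \/
  (exists2 i, x = pos i & b = vpath i ord_max).
Proof.
case: b => [y xy|[i [u|k]]]; first by left; exists y.
  by rewrite /= /limb_end andbF.
by case/andP=> /eqP-> /eqP/= ->; right; exists i.
Qed.

Lemma glue_edge_child i (u : vert (c i)) b : glue_edge (vchild u) b ->
  (exists2 w, b = vchild w & adj (c i) u w) \/
  (u = port (c i) /\ b = vpath i ord0).
Proof.
case: b => [y|[j y]]; first by rewrite /= /limb_end andbF.
have [ij|ij] := eqVneq i j; last by rewrite /= (negPf ij).
subst j; rewrite glue_edge_limb; case: y => [w uw|k]; first by left; exists w.
by case/andP=> /eqP-> /eqP->; right.
Qed.

Lemma glue_edge_path i (k : 'I_L.+1) b : glue_edge (vpath i k) b ->
  [\/ k = ord0 /\ b = vchild (port (c i)), k = ord_max /\ b = inl (pos i),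
    exists2 j : 'I_L.+1, k = j.+1 :> nat & b = vpath i j |
    exists2 j : 'I_L.+1, j = k.+1 :> nat & b = vpath i j].
Proof.
case: b => [y /andP[/eqP-> /eqP/= ->]|[j y]]; first by constructor 2.
have [ij|ij] := eqVneq i j; last by rewrite /= (negPf ij).
subst j; rewrite glue_edge_limb; case: y => [w /andP[/eqP-> /eqP->]|j].
  by constructor 1.
by case/orP=> /eqP kj; [constructor 4 | constructor 3]; exists j.
Qed.

Hypothesis eK_sym : symmetric eK.
Hypothesis c_sym : forall i, symmetric (adj (c i)).

Lemma glue_edge_sym : symmetric glue_edge.
Proof.
case=> [x|[i x]] [y|[j y]] //; first exact: eK_sym.
have [ij|ij] := eqVneq i j; last by rewrite /= (negPf ij) eq_sym (negPf ij).
subst j; rewrite !glue_edge_limb; case: x y => [u|k] [w|l] //=.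
  exact: c_sym.
by rewrite orbC.
Qed.

Lemma vchild_inj i : injective (@vchild i).
Proof.
move=> u w /eqP; rewrite /vchild /vlimb (inj_eq (@inr_inj _ _)) eq_Tagged.
by move/eqP=> [].
Qed.

Lemma vchild_li_hom i : li_hom (adj (c i)) glue_edge (@vchild i).
Proof.
apply: li_hom_of_inj => [u w uw|u v w _ _]; last exact: vchild_inj.
by rewrite glue_edge_limb.
Qed.

Lemma vcore_li_hom : li_hom eK glue_edge inl.
Proof. by apply: li_hom_of_inj => // x y z _ _ []. Qed.

Lemma glue_connected : connected_graph eK ->
  (forall i, connected_graph (adj (c i))) -> connected_graph glue_edge.
Proof.
move=> [/card_gt0P[x0 _] _ Kconn] cconn; split.
- by apply/card_gt0P; exists (inl x0).
- exact: glue_edge_sym.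
have conn_sym := sym_connect_sym glue_edge_sym.
suff to_x0 a : connect glue_edge a (inl x0).
  by move=> a b; apply: connect_trans (to_x0 a) _; rewrite conn_sym.
have core x : connect glue_edge (inl x) (inl x0).
  exact: (hom_connect vcore_li_hom.1 (Kconn x x0)).
have pathc i m (k : 'I_L.+1) : L - k = m ->
    connect glue_edge (vpath i k) (inl x0).
  elim: m k => [|m IHm] k km.
    have -> : k = ord_max by apply/val_inj => /=; have := ltn_ord k; lia.
    apply: connect_trans (core (pos i)); apply: connect1.
    by rewrite /= /limb_end /= !eqxx.
  have kL : k.+1 < L.+1 by lia.
  apply: connect_trans (IHm (Ordinal kL) _); last by rewrite /=; lia.
  by apply: connect1; rewrite glue_edge_limb /= eqxx.
move: a; apply: glueP => // i => [u|k]; last exact: pathc.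
apply: connect_trans (pathc i _ ord0 erefl).
apply: (@connect_trans _ _ (vchild (port (c i)))).
  have [_ _ conn] := cconn i.
  exact: (hom_connect (vchild_li_hom i).1 (conn u _)).
by apply: connect1; rewrite glue_edge_limb /= !eqxx.
Qed.

Lemma nbwalk_limb i : nbwalk glue_edge L.+1
  (vchild (port (c i))) (vpath i ord0) (vpath i ord_max) (inl (pos i)).
Proof.
(* Induction on the distance to the core end. The predecessor [a] is kept general, subject only to
   differing from all vertices still ahead, which rules out backtracking. *)
have from m (k : 'I_L.+1) a : L - k = m -> glue_edge a (vpath i k) ->
    a != inl (pos i) -> (forall j : 'I_L.+1, k < j -> a != vpath i j) ->
    nbwalk glue_edge m.+1 a (vpath i k) (vpath i ord_max) (inl (pos i)).
  elim: m k a => [|m IHm] k a km ak apos aj.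
    have -> : ord_max = k by apply/val_inj => /=; have := ltn_ord k; lia.
    apply: NbwalkS ak apos _; apply: Nbwalk0; rewrite /= /limb_end /= eqxx.
    by apply/eqP/val_inj => /=; have := ltn_ord k; lia.
  have kL : k.+1 < L.+1 by lia.
  apply: NbwalkS ak (aj (Ordinal kL) (leqnn _)) _; apply: IHm => //=.
  - by rewrite subnS km.
  - by rewrite eqxx tagged_asE /= eqxx.
  move=> j kj; rewrite /vpath /vlimb (inj_eq (@inr_inj _ _)) eq_Tagged.
  by apply/eqP => -[] jk; move: kj; rewrite -jk; lia.
apply: from; rewrite ?subn0 //.
  by rewrite glue_edge_limb /= !eqxx.
by move=> j _; rewrite /vpath /vchild /vlimb (inj_eq (@inr_inj _ _)) eq_Tagged.
Qed.

(** Each path is sent along a non-backtracking walk. Its first step [y] avoids the images of the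
    neighbours of the port, and its last interior vertex [u] avoids those of the core neighbours of
    [pos i]; this gives local injectivity at the two ends. Injectivity of [pos] puts at most one
    limb on each core vertex. *)
Lemma glue_hom (U : finType) (e : rel U) (h : K -> U) :
  symmetric e -> injective pos -> li_hom eK e h ->
  (forall i, exists (f : vert (c i) -> U) y u,
     [/\ li_hom (adj (c i)) e f, forall z, adj (c i) (port (c i)) z -> f z != y,
         forall x, eK (pos i) x -> h x != u &
         nbwalk e L.+1 (f (port (c i))) y u (h (pos i))]) ->
  exists2 F : glue -> U, li_hom glue_edge e F & forall x, F (inl x) = h x.
Proof.
move=> e_sym pos_inj hh H.
(* The walk becomes a sequence [p.2], with the image of the port at index 0 and that of [pos i] at
   index [L.+2]; hence path vertex [k] goes to index [k.+1]. *)
have {}H i : exists p : (vert (c i) -> U) * (nat -> U),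
  [/\ li_hom (adj (c i)) e p.1,
      (forall z, adj (c i) (port (c i)) z -> p.1 z != p.2 1),
      (forall x, eK (pos i) x -> h x != p.2 L.+1),
      p.2 0 = p.1 (port (c i)) /\ p.2 L.+2 = h (pos i) &
      (forall k, k <= L.+1 -> e (p.2 k) (p.2 k.+1)) /\
      (forall k, k < L.+1 -> p.2 k != p.2 k.+2)].
  have [f [y [u [fh fy hu /nbwalkP[g [[g0 g1 gL gL1] ge gnb]]]]]] := H i.
  by subst y u; exists (f, g).
pose fg i := sval (cid (H i)).
pose F (a : glue) := match a with
  | inl x => h x
  | inr (existT i (inl u)) => (fg i).1 u
  | inr (existT i (inr k)) => (fg i).2 k.+1
  end.
exists F => //.
have fgP i := svalP (cid (H i)).
(* A path vertex has exactly two neighbours, sent to indices [k] and [k.+2], whose values differ by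
   non-backtracking. *)
pose prev i (k : 'I_L.+1) : glue :=
  if k == ord0 then vchild (port (c i)) else vpath i (inord k.-1).
pose next i (k : 'I_L.+1) : glue :=
  if k == ord_max then inl (pos i) else vpath i (inord k.+1).
have Fpath i (k : 'I_L.+1) a : glue_edge (vpath i k) a ->
    (a = prev i k /\ F a = (fg i).2 k) \/ (a = next i k /\ F a = (fg i).2 k.+2).
  have [_ _ _ [g0 gL] _] := fgP i.
  case/glue_edge_path=> [[-> ->]|[-> ->]|[j kj ->]|[j kj ->]].
  - by left.
  - by right; rewrite /next eqxx.
  - left; rewrite /prev -val_eqE /= kj /=; split=> //.
    by congr vpath; apply/val_inj; rewrite /= inordK.
  right; rewrite /next -val_eqE /= -kj; case: eqP => [kL|_].
    by move: (ltn_ord j); rewrite kj kL ltnn.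
  by split=> //; congr vpath; apply/val_inj; rewrite /= inordK.
apply: li_hom_of_inj.
  apply: glueP => [x|i u|i k] b.
  - case/glue_edge_core=> [[y -> /hh.1 //]|[i -> ->]].
    have [_ _ _ [_ gL] [ge _]] := fgP i.
    by rewrite e_sym /F /= -gL ge.
  - have [hf _ _ [g0 _] [ge _]] := fgP i.
    case/glue_edge_child=> [[w -> /hf.1 //]|[-> ->]].
    by rewrite /F /= -g0 ge.
  have [_ _ _ _ [ge _]] := fgP i; have kL := ltn_ord k.
  case/Fpath=> [[_ ->]|[_ ->]]; last exact: ge.
  by rewrite e_sym; apply: ge; rewrite ltnW.
apply: glueP => [x|i u|i k] b b'.
- case/glue_edge_core=> [[y -> xy]|[i xi ->]];
    case/glue_edge_core=> [[z -> xz]|[j xj ->]].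
  + by move/(li_hom_inj hh xy xz) ->.
  + have [_ _ hg _ _] := fgP j; rewrite xj in xy.
    by move/eqP; rewrite (negPf (hg y xy)).
  + have [_ _ hg _ _] := fgP i; rewrite xi in xz.
    by move/esym/eqP; rewrite (negPf (hg z xz)).
  by move: xi; rewrite xj => /pos_inj ->.
- have [hf fg1 _ _ _] := fgP i.
  case/glue_edge_child=> [[w -> uw]|[ui ->]];
    case/glue_edge_child=> [[w' -> uw']|[uj ->]] //.
  + by move/(li_hom_inj hf uw uw') ->.
  + by rewrite uj in uw => /eqP; rewrite (negPf (fg1 _ uw)).
  by rewrite ui in uw' => /esym/eqP; rewrite (negPf (fg1 _ uw')).
have [_ _ _ _ [_ gnb]] := fgP i; have /eqP gk := gnb _ (ltn_ord k).
by case/Fpath=> [[-> ->]|[-> ->]]; case/Fpath=> [[-> ->]|[-> ->]] // /esym.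
Qed.

End Glue.

(** * The core: a looped cycle with a complete graph attached *)

Section Core.

Variable l : nat.

(** The four elements of [bool * bool] form the complete graph, joined through [apex] to position 0
    of the cycle. The disjunct [x == y] of [cycle_edge] supplies the loops. *)
Definition core : finType := ('Z_l + bool * bool)%type.

Definition apex : bool * bool := (false, false).

Definition cycle_edge (x y : 'Z_l) : bool :=
  [|| x == y, y == x + 1 | x == y + 1]%R.

Definition core_edge : rel core := fun a b =>
  match a, b with
  | inl x, inl y => cycle_edge x y
  | inr p, inr q => p != q
  | inl x, inr p | inr p, inl x => (x == 0%R) && (p == apex)
  end.

Lemma core_edge_sym : symmetric core_edge.
Proof.
case=> [x|p] [y|q] //=; last by rewrite eq_sym.
by rewrite /cycle_edge eq_sym; case: eqVneq => //= _; rewrite orbC.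
Qed.

Lemma core_connected : connected_graph core_edge.
Proof.
have conn_sym := sym_connect_sym core_edge_sym.
split; [by apply/card_gt0P; exists (inl 0%R) | exact: core_edge_sym |].
suff to0 a : connect core_edge a (inl 0%R).
  by move=> a b; apply: connect_trans (to0 a) _; rewrite conn_sym.
case: a => [x|p].
  rewrite -(natr_Zp x); elim: (nat_of_ord x) => [//|n IHn].
  apply: connect_trans IHn; apply: connect1.
  by rewrite /= /cycle_edge -natr1 eqxx !orbT.
have conn_apex : connect core_edge (inr apex) (inl 0%R).
  by apply: connect1; rewrite /= !eqxx.
have [-> //|p_apex] := eqVneq p apex.
exact: connect_trans (connect1 _) conn_apex.
Qed.

(* A complete graph on four vertices has closed walks of lengths 3 and 4, hence
   of every length from 6 on. *)
Lemma nbwalk_apex n : 10 <= n ->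
  nbwalk core_edge n (inl 0%R) (inr apex) (inr apex) (inl 0%R).
Proof.
move=> n10.
pose s : core := inr apex; pose a : core := inr (true, false).
pose b : core := inr (false, true); pose d : core := inr (true, true).
have w3 : nbwalk core_edge 3 s a s a.
  apply: (NbwalkS (z := b)) => //; apply: (NbwalkS (z := s)) => //.
  by apply: (NbwalkS (z := a)) => //; apply: Nbwalk0.
have w4 : nbwalk core_edge 4 s a s a.
  apply: (NbwalkS (z := b)) => //; apply: (NbwalkS (z := d)) => //.
  apply: (NbwalkS (z := s)) => //; apply: (NbwalkS (z := a)) => //.
  exact: Nbwalk0.
have wS m : 6 <= m -> nbwalk core_edge m s a s a.
  have [k] := ubnP m; elim: k m => // k IHk m mk m6.
  have [m9|m9] := leqP 9 m.
    have -> : m = 3 + (m - 3) by lia.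
    by apply: nbwalk_trans w3 _; apply: IHk; lia.
  have [->|[->|->]] : m = 3 + 3 \/ m = 3 + 4 \/ m = 4 + 4 by lia.
  - exact: (nbwalk_trans w3 w3).
  - exact: (nbwalk_trans w3 w4).
  exact: (nbwalk_trans w4 w4).
(* One step leads in, three lead out, and the [n - 4] between must be at least 6; hence the bound
   10. *)
have -> : n = (1 + (n - 4 + 3)) by lia.
have edge0 : core_edge (inl 0%R) s by rewrite /= !eqxx.
apply: (@nbwalk_trans _ _ _ _ _ _ s a).
  by apply: (NbwalkS (z := a) edge0) => //; apply: Nbwalk0.
apply: (nbwalk_trans (wS _ _)); first by lia.
apply: (NbwalkS (z := b)) => //; apply: (NbwalkS (z := s)) => //.
apply: (NbwalkS (z := inl 0%R)) => //; apply: Nbwalk0.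
by rewrite core_edge_sym.
Qed.

Hypothesis l_gt2 : 2 < l.

Let l_gt1 : 1 < l := ltnW l_gt2.

Lemma natr_Zp_eq0 n : (n%:R == 0 :> 'Z_l)%R = (l %| n).
Proof. by rewrite -val_eqE /= val_Zp_nat. Qed.

Lemma Zp_two_neq0 : (1 + 1 != 0 :> 'Z_l)%R.
Proof.
have -> : (1 + 1 = 2%:R :> 'Z_l)%R by [].
by rewrite natr_Zp_eq0; apply/negP => /dvdn_leq; lia.
Qed.

Lemma natr_Zp_inj m n : m < l -> n < l -> (m%:R = n%:R :> 'Z_l)%R -> m = n.
Proof.
by move=> ml nl /(congr1 val) /=; rewrite !val_Zp_nat // !modn_small.
Qed.

(** Run down the cycle to position 0 and turn round in the complete graph: [k.+1] steps, then at
    least the 10 of [nbwalk_apex]. *)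
Lemma nbwalk_descent k n : k + 11 <= n ->
  nbwalk core_edge n (inl k.+1%:R%R) (inl k%:R%R) (inr apex) (inl 0%R).
Proof.
have edge m : core_edge (inl m.+1%:R%R) (inl m%:R%R).
  by rewrite /= /cycle_edge -natr1 eqxx !orbT.
elim: k n => [|k IHk] [|n] kn //.
  apply: NbwalkS (edge 0) _ (nbwalk_apex _) => //.
apply: NbwalkS (edge k.+1) _ (IHk n _) => //.
rewrite -[k.+2]addn2 natrD (inj_eq (@inl_inj _ _)) -subr_eq0 addrAC subrr add0r.
exact: Zp_two_neq0.
Qed.

Lemma core_edge_cycle x a : core_edge (inl x) a ->
  (exists2 d, d \in [:: 0; 1; -1]%R & a = inl (x + d)%R) \/
  x = 0%R /\ a = inr apex.
Proof.
case: a => [y|p] /=; last by case/andP=> /eqP-> /eqP->; right.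
case/or3P=> /eqP xy; left; [exists 0%R | exists 1%R | exists (-1)%R];
  by rewrite ?inE ?eqxx ?orbT // xy ?addr0 ?addrK.
Qed.

(** A walk that neither stalls nor reverses repeats its first step [d], which is 1 or -1. So
    [y k = y 0 + d *+ k], and a return at [k] makes [k] vanish modulo [l]. *)
Lemma cycle_steps_dvd (y : nat -> 'Z_l) k :
  (forall i, cycle_edge (y i) (y i.+1)) -> (forall i, y i != y i.+1) ->
  (forall i, y i != y i.+2) -> y k = y 0 -> l %| k.
Proof.
move=> ye y1 y2 yk.
have step i : y i.+1 = (y i + 1)%R \/ y i.+1 = (y i - 1)%R.
  case/or3P: (ye i) => /eqP E; first by move: (y1 i); rewrite {1}E eqxx.
    by left.
  by right; rewrite E addrK.
pose d : 'Z_l := (y 1 - y 0)%R.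
have yS i : y i.+1 = (y i + d)%R.
  elim: i => [|i IHi]; first by rewrite addrC subrK.
  have -> : d = (y i.+1 - y i)%R by rewrite IHi; ring.
  have := y2 i; case: (step i) (step i.+1) => [E1|E1] [E2|E2]; rewrite E2 E1.
  - by move=> _; ring.
  - by rewrite addrK eqxx.
  - by rewrite subrK eqxx.
  by move=> _; ring.
have yE i : y i = (y 0 + d *+ i)%R.
  by elim: i => [|i IHi]; rewrite ?mulr0n ?addr0 // yS IHi mulrSr -addrA.
have dk : (d *+ k = 0)%R by apply: (addrI (y 0)); rewrite -yE yk addr0.
rewrite -natr_Zp_eq0; apply/eqP; move: dk; rewrite /d.
case: (step 0) => ->; rewrite addrAC subrr add0r // mulNrn.
by move/eqP; rewrite oppr_eq0 => /eqP.
Qed.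

End Core.

(** * Wrapping a cycle around a shorter one *)

Section Wrap.

Variables (l l' : nat).
Hypotheses (l_gt2 : 2 < l) (l'_gt2 : 2 < l') (dvd_l : l' %| l).

Definition wrap_core (a : core l) : core l' :=
  match a with inl x => inl (x : nat)%:R%R | inr p => inr p end.

Lemma wrap_nat n : wrap_core (inl n%:R%R) = inl n%:R%R.
Proof.
rewrite /= val_Zp_nat 1?ltnW // {2}(divn_eq n l) natrD natrM.
have -> : l%:R%R = 0%R :> 'Z_l' by apply/eqP; rewrite natr_Zp_eq0.
by rewrite mulr0 add0r.
Qed.

(** Reduction modulo [l'] commutes with the shifts by 0, 1 and -1 that lead to the cycle neighbours,
    and these shifts stay distinct because [2 < l']. The complete graph is mapped identically. *)
Lemma wrap_li_hom : li_hom (@core_edge l) (@core_edge l') wrap_core.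
Proof.
pose w (x : 'Z_l) : 'Z_l' := (x : nat)%:R%R.
have wn n : w n%:R%R = n%:R%R by have [] := wrap_nat n.
have w1 x : w (x + 1)%R = (w x + 1)%R.
  by rewrite -{1}[x]natr_Zp natr1 wn -natr1.
have w0 : w 0%R = 0%R by apply: (wn 0).
have wN x : w (x - 1)%R = (w x - 1)%R by rewrite -{2}[x](subrK 1%R) w1 addrK.
have two := Zp_two_neq0 l'_gt2.
have wE x : wrap_core (inl x) = inl (w x) by [].
have wD0 x : w (x + 0)%R = (w x + 0)%R by rewrite !addr0.
apply: li_hom_of_inj => [[x|p] [y|q]|].
- rewrite !wE /= /cycle_edge => /or3P[]/eqP->;
    by rewrite ?w1 eqxx ?orbT.
- by case/andP=> /eqP-> /eqP->; rewrite wE w0 /= !eqxx.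
- by case/andP=> /eqP-> /eqP->; rewrite wE w0 /= !eqxx.
- by [].
case=> [x|p] a b; last first.
  case: a b => [y|q] [z|q'] //=; last by move=> _ _ [->].
  by case/andP=> /eqP-> _ /andP[/eqP-> _].
have one_opp : (1 == -1 :> 'Z_l')%R = false.
  by apply/negbTE; rewrite -addr_eq0.
have zero1 : (0 == 1 :> 'Z_l')%R = false by [].
have zeroN1 : (0 == -1 :> 'Z_l')%R = false by rewrite eq_sym oppr_eq0.
case/core_edge_cycle=> [[d dP ->]|[-> ->]];
  case/core_edge_cycle=> [[d' d'P ->]|[_ ->]] //; rewrite !wE.
by move: dP d'P; rewrite !inE => /or3P[]/eqP-> /or3P[]/eqP-> // [];
  rewrite ?wD0 ?w1 ?wN => /addrI/eqP;
  rewrite ?zero1 ?zeroN1 ?one_opp // eq_sym ?zero1 ?zeroN1 ?one_opp.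
Qed.

End Wrap.

(** * Distinct primes by Euclid's construction *)

Fixpoint sparse_prime (n : nat) : nat :=
  if n is m.+1 then pdiv (sparse_prime m)`!.+1 else 5.

Lemma sparse_prime_prime n : prime (sparse_prime n).
Proof. by case: n => [//|n]; apply: pdiv_prime; rewrite ltnS fact_gt0. Qed.

Lemma sparse_primeS n : sparse_prime n < sparse_prime n.+1.
Proof.
rewrite ltnNge; apply/negP => le_p.
have := pdiv_dvd (sparse_prime n)`!.+1; rewrite -/(sparse_prime n.+1).
have p_pr := sparse_prime_prime n.+1.
rewrite -[X in _ %| X]addn1 dvdn_addr ?dvdn_fact ?prime_gt0 // dvdn1 => /eqP p1.
by rewrite p1 in p_pr.
Qed.

Lemma sparse_prime_inj : injective sparse_prime.
Proof.
have mono : {homo sparse_prime : i j / i < j}.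
  exact: homo_ltn ltn_trans sparse_primeS.
by move=> m n; case: (ltngtP m n) => // /mono /[swap] ->; rewrite ltnn.
Qed.

(** Starting the primes at 5 leaves room on the [n]-th cycle for the port and up to [n] sockets. *)
Lemma sparse_prime_gt n : n.+4 < sparse_prime n.
Proof. by elim: n => // n IHn; apply: leq_ltn_trans IHn (sparse_primeS n). Qed.

(** * Cycle lengths, limb lengths and the sequence of graphs *)

Section UniversalSequence.

Variable r : rel nat.
Hypotheses (r_refl : reflexive r) (r_anti : antisymmetric r).
Hypothesis r_trans : transitive r.

Definition cofactor_of (n : nat) : nat :=
  \prod_(0 <= j < n) (if r n j then sparse_prime j else 1).

Definition girth_of (n : nat) : nat := cofactor_of n * sparse_prime n.

(** For [b < n] a limb must be long enough to be sent down a limb of the [b]-th graph, along its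
    cycle and through a turn in its complete graph; the 12 covers the turn and the connecting
    steps. *)
Definition limb_length (n : nat) : nat := \sum_(0 <= m < n) (girth_of m + 12).

Lemma cofactor_gt0 n : 0 < cofactor_of n.
Proof.
apply: prodn_gt0 => j; case: ifP => // _.
exact: prime_gt0 (sparse_prime_prime j).
Qed.

Lemma ltn_cofactor_girth n j : j < n.+2 -> cofactor_of n * j.+1 < girth_of n.
Proof.
move=> jn; rewrite ltn_pmul2l ?cofactor_gt0 //.
have := sparse_prime_gt n; lia.
Qed.

Lemma girth_gt2 n : 2 < girth_of n.
Proof.
by have := ltn_cofactor_girth (ltnSn n.+1); have := cofactor_gt0 n; nia.
Qed.

(** The factor of [cofactor_of m] at [j = b] is [sparse_prime b]; by transitivity every prime in
    [cofactor_of b] recurs among the factors with [j < b]. *)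
Lemma dvdn_girth_cofactor b m : b < m -> r m b -> girth_of b %| cofactor_of m.
Proof.
move=> bm rmb; rewrite /cofactor_of (big_cat_nat_idem _ (n := b.+1)) //=.
rewrite dvdn_mulr // big_nat_recr //= rmb /girth_of dvdn_mul //.
rewrite /cofactor_of; apply: (big_ind2 (fun x y => x %| y)) => //
  [x x' y y'|j _].
  exact: dvdn_mul.
by case: ifP => // rbj; rewrite (r_trans rmb rbj).
Qed.

(** The prime [sparse_prime m] must be one of the prime factors of [girth_of a], which are
    [sparse_prime a] and the [sparse_prime j] with [r a j]. *)
Lemma dvdn_girth m a : girth_of m %| girth_of a -> r a m.
Proof.
move=> ma; have : sparse_prime m %| girth_of a.
  exact: dvdn_trans (dvdn_mull _ (dvdnn _)) ma.
have m_pr := sparse_prime_prime m.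
have p_dvd j : sparse_prime m %| sparse_prime j -> m = j.
  by rewrite dvdn_prime2 ?sparse_prime_prime // => /eqP/sparse_prime_inj.
rewrite Euclid_dvdM // => /orP[|/p_dvd -> //].
apply: (big_ind (fun x => sparse_prime m %| x -> r a m)).
- by rewrite dvdn1 => /eqP p1; rewrite p1 in m_pr.
- by move=> x y IHx IHy; rewrite Euclid_dvdM // => /orP[].
move=> j _; case: ifP => [raj /p_dvd -> //|_].
by rewrite dvdn1 => /eqP p1; rewrite p1 in m_pr.
Qed.

Lemma leq_limb_length b m : b < m ->
  limb_length b + girth_of b + 12 <= limb_length m.
Proof.
move=> bm; rewrite /limb_length [leqRHS](big_cat_nat_idem _ (n := b.+1)) //=.
by rewrite big_nat_recr //= addnA leq_addr.
Qed.

Definition below (n : nat) : finType := {i : 'I_n | r i n}.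

(* Multiples of the cofactor vanish modulo the girth of every b < n with r n b,
   so wrapping takes the sockets and the port to position 0, where the complete
   graph hangs. Multiplier 0 is that position, 1 is the port. *)
Definition socket (n : nat) (i : below n) : core (girth_of n) :=
  inl (cofactor_of n * (val (val i)).+2)%:R%R.

Definition assemble (n : nat) (G : nat -> pgraph) : pgraph :=
  PGraph (@glue_edge _ (@core_edge (girth_of n)) _
            (fun i : below n => G (val (val i))) (@socket n) (limb_length n))
         (inl (inl (cofactor_of n)%:R%R)).

(** Course-of-values recursion through the list of the graphs built so far; [empty_pgraph] is only
    the default value of [nth]. *)
Definition empty_pgraph : pgraph := @PGraph unit (fun _ _ => false) tt.

Fixpoint tree_prefix (n : nat) : seq pgraph :=
  if n is m.+1
  then rcons (tree_prefix m) (assemble m (nth empty_pgraph (tree_prefix m)))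
  else [::].

Definition cycle_tree (n : nat) : pgraph :=
  assemble n (nth empty_pgraph (tree_prefix n)).

Lemma nth_tree_prefix n i : i < n ->
  nth empty_pgraph (tree_prefix n) i = cycle_tree i.
Proof.
have size_prefix m : size (tree_prefix m) = m.
  by elim: m => //= m IHm; rewrite size_rcons IHm.
elim: n => //= n IHn; rewrite nth_rcons size_prefix ltnS leq_eqVlt.
by case: ltngtP => //= [/IHn //|->].
Qed.

Lemma cycle_treeE n : cycle_tree n = assemble n cycle_tree.
Proof.
rewrite {1}/cycle_tree /assemble.
suff -> : (fun i : below n => nth empty_pgraph (tree_prefix n) (val (val i))) =
          (fun i : below n => cycle_tree (val (val i))) by [].
by apply: funext => i; rewrite nth_tree_prefix ?ltn_ord.
Qed.

Lemma socket_bounds n (i : below n) :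
  0 < cofactor_of n * (val (val i)).+2 < girth_of n.
Proof.
rewrite muln_gt0 cofactor_gt0 ltn_cofactor_girth //.
by rewrite !ltnS (ltnW (ltn_ord _)).
Qed.

Lemma socket_inj n : injective (@socket n).
Proof.
move=> i j [].
have [/andP[_ ilt] /andP[_ jlt]] := (socket_bounds i, socket_bounds j).
move/(natr_Zp_inj (girth_gt2 n) ilt jlt)/eqP.
rewrite eqn_pmul2l ?cofactor_gt0 // !eqSS => /eqP ij.
exact/val_inj/val_inj.
Qed.

Lemma cycle_tree_connected n : connected_graph (adj (cycle_tree n)).
Proof.
have [k] := ubnP n; elim: k n => // k IHk n nk.
have conn i (_ : below n) : i < n -> connected_graph (adj (cycle_tree i)).
  by move=> /leq_trans/(_ nk); apply: IHk.
have {}conn (i : below n) : connected_graph (adj (cycle_tree (val (val i)))).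
  exact: conn i (ltn_ord _).
rewrite cycle_treeE; apply: glue_connected => //.
- exact: core_edge_sym.
- by move=> i; have [] := conn i.
exact: core_connected.
Qed.

Lemma cycle_tree_sym n : symmetric (adj (cycle_tree n)).
Proof. by have [] := cycle_tree_connected n. Qed.

(** * Homomorphisms between graphs with related indices *)

Definition hub n : vert (assemble n cycle_tree) := inl (inl 0%R).
Definition turn n : vert (assemble n cycle_tree) := inl (inr apex).

(* The condition under which X, hung on a longer limb at a multiple of the
   girth of b, still maps to the b-th graph: the limb is sent to a walk that
   turns round in the complete graph. *)
Definition extendable (b : nat) (X : pgraph) : Prop :=
  exists (f : vert X -> vert (assemble b cycle_tree)) z,
  [/\ li_hom (adj X) (adj (assemble b cycle_tree)) f,
      forall y, adj X (port X) y -> f y != z &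
      forall n, limb_length b + girth_of b + 12 <= n ->
        nbwalk (adj (assemble b cycle_tree)) n (f (port X)) z (turn b) (hub b)].

(** The map is the inclusion as a child. The walk follows the limb to its socket, runs down the
    cycle to [hub b], and turns round in the complete graph. *)
Lemma extendable_below b (i : below b) :
  extendable b (cycle_tree (val (val i))).
Proof.
set c := fun j : below b => cycle_tree (val (val j)).
exists (@vchild _ _ c (limb_length b) i), (vpath _ c i ord0); split.
- exact: vchild_li_hom.
- by move=> y _; rewrite /vchild /vpath /vlimb (inj_eq (@inr_inj _ _)) eq_Tagged.
move=> n nb; set k := cofactor_of b * (val (val i)).+2.
have /andP[k_gt0 k_lt] : 0 < k < girth_of b := socket_bounds i.
have w := nbwalk_limb (@core_edge (girth_of b)) c (@socket b)
  (limb_length b) i.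
(* The limb takes [(limb_length b).+1] steps, one more step enters the cycle towards position
   [k.-1], and [nbwalk_descent] absorbs the rest. *)
have n_eq : n = (limb_length b).+1 + (n - (limb_length b).+2).+1 by lia.
rewrite n_eq; apply: (nbwalk_trans w).
apply: (@NbwalkS _ _ _ _ _ (inl (inl k.-1%:R%R))) => //.
  by rewrite /= /limb_end /= !eqxx.
have := @nbwalk_descent _ (girth_gt2 b) k.-1 (n - (limb_length b).+2).
rewrite prednK // => /(_ ltac:(lia)).
exact: (nbwalk_hom (@core_edge_sym _) (vcore_li_hom _ _ _ _)).
Qed.

(** The core is wrapped around that of [b]. A child index [i] of [m] satisfies [r i b] by
    transitivity: it is below [b], or above [b] and covered by induction, but never [b] itself,
    since antisymmetry would then give [b = m]. *)
Lemma extendable_above b m : b < m -> r m b -> extendable b (cycle_tree m).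
Proof.
have [k] := ubnP m; elim: k m => // k IHk m mk bm rmb.
rewrite cycle_treeE.
have dvd_bm := dvdn_girth_cofactor bm rmb.
have b3 := girth_gt2 b; have m3 := girth_gt2 m.
have girth_dvd : girth_of b %| girth_of m by rewrite dvdn_mulr.
set c := fun j : below m => cycle_tree (val (val j)).
have sym_b : symmetric (adj (assemble b cycle_tree)).
  by rewrite -cycle_treeE; apply: cycle_tree_sym.
pose h (a : core (girth_of m)) : vert (assemble b cycle_tree) :=
  inl (wrap_core (girth_of b) a).
have hh : li_hom (@core_edge (girth_of m)) (adj (assemble b cycle_tree)) h.
  exact: li_hom_comp (wrap_li_hom m3 b3 girth_dvd) (vcore_li_hom _ _ _ _).
have h0 x : girth_of b %| x -> h (inl x%:R%R) = hub b.
  move=> bx; rewrite /h wrap_nat //; congr (inl (inl _)).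
  by apply/eqP; rewrite natr_Zp_eq0.
(* In the core of [m] only position 0 touches the complete graph. At a socket or the port, [turn b]
   is therefore not the image of a core neighbour and is free for the walk. *)
have no_turn x y : 0 < x < girth_of m ->
    core_edge (inl x%:R%R : core (girth_of m)) y -> h y != turn b.
  move=> /andP[x0 xm]; case: y => [y _|p /andP[/eqP x_0 _]].
    by rewrite /h /turn (inj_eq (@inl_inj _ _)).
  by move: x0; rewrite (@natr_Zp_inj _ m3 x 0 xm _ x_0) //; lia.
have [|F hF Fh] := glue_hom (c := c) (L := limb_length m) sym_b
    (@socket_inj m) hh.
  move=> i; have im := ltn_ord (val i).
  have [f [z [hf fz w]]] : extendable b (c i).
    have rib : r (val (val i)) b by apply: r_trans rmb; apply: (valP i).
    case: (ltngtP (val (val i)) b) => [ib|ib|ib].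
    - exact: (@extendable_below b (Sub (Ordinal ib) rib)).
    - by apply: IHk => //; apply: leq_trans im _.
    move: (valP i) => /=; rewrite ib => rbm.
    by move: bm; rewrite (@r_anti b m) ?ltnn // rbm rmb.
  exists f, z, (turn b); split=> //.
    by move=> x; apply/no_turn/socket_bounds.
  rewrite h0; last by rewrite dvdn_mulr.
  by apply: w; have := leq_limb_length bm; lia.
(* The port also lands on [hub b], so the required walk just turns round in the complete graph. No
   limb hangs at the port, whose multiplier 1 is not of the form [i.+2]. *)
exists F, (turn b); split=> // [y|n nb].
  have cof_lt : 0 < cofactor_of m < girth_of m.
    rewrite cofactor_gt0 /=.
    by have := @ltn_cofactor_girth m 0 isT; rewrite muln1.
  case/glue_edge_core=> [[x -> xy]|[i + _]].
    by rewrite Fh (no_turn _ _ cof_lt).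
  have /andP[_ i_lt] := socket_bounds i.
  case=> /(natr_Zp_inj m3 (andP cof_lt).2 i_lt)/eqP.
  by rewrite -[X in X == _]muln1 eqn_pmul2l ?cofactor_gt0.
rewrite /= Fh h0 //.
apply: (nbwalk_hom (@core_edge_sym _) (vcore_li_hom _ _ _ _)).
apply: nbwalk_apex; lia.
Qed.

Lemma extendable_hom b (X : pgraph) : extendable b X ->
  exists f, li_hom (adj X) (adj (cycle_tree b)) f.
Proof. by rewrite cycle_treeE => -[f [z [hf _ _]]]; exists f. Qed.

Lemma cycle_tree_hom a b : r a b ->
  exists f, li_hom (adj (cycle_tree a)) (adj (cycle_tree b)) f.
Proof.
move=> rab; case: (ltngtP a b) => [ab|ab|<-].
- exact: extendable_hom (@extendable_below b (Sub (Ordinal ab) rab)).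
- exact/extendable_hom/extendable_above.
by exists id; split=> // v x y.
Qed.

(** * Homomorphisms force the relation *)

Lemma looped_walk_dvd b (g : nat -> vert (cycle_tree b)) l :
  (forall k, adj _ (g k) (g k)) -> (forall k, adj _ (g k) (g k.+1)) ->
  (forall k, g k != g k.+1) -> (forall k, g k != g k.+2) -> g l = g 0 ->
  exists2 m, r m b & girth_of m %| l.
Proof.
have [n] := ubnP b; elim: n b g => // n IHn b + bn; rewrite cycle_treeE.
move=> g loop edge g1 g2 gl.
set c := fun j : below b => cycle_tree (val (val j)).
pose e := glue_edge (@core_edge _) (c := c) (@socket b) (L := limb_length b).
have {}loop k : e (g k) (g k) := loop k.
have {}edge k : e (g k) (g k.+1) := edge k.
(* Only cycle vertices carry loops, so the sequence never leaves the cycle on which it starts: that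
   of [b], or one inside a child, where the induction hypothesis applies. *)
case g0: (g 0) (loop 0) => [[x|p]|[i [u|k]]].
- move=> _; have gk k : exists y, g k = inl (inl y).
    elim: k => [|k [y gk]]; first by exists x.
    have := edge k; rewrite gk.
    case/glue_edge_core=> [[[y'|p] gk1 _]|[i _ gk1]]; first by exists y'.
      by have := loop k.+1; rewrite gk1 /= eqxx.
    by have := loop k.+1; rewrite gk1 /e vpath_unlooped.
  pose y k := sval (cid (gk k)).
  have gy k : g k = inl (inl (y k)) := svalP (cid (gk k)).
  exists b; first exact: r_refl.
  apply: (@cycle_steps_dvd _ (girth_gt2 b) y).
  + by move=> k; have := edge k; rewrite !gy.
  + by move=> k; apply: contra_neq (g1 k) => yk; rewrite !gy yk.
  + by move=> k; apply: contra_neq (g2 k) => yk; rewrite !gy yk.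
  by move: gl; rewrite !gy => -[].
- by rewrite /= eqxx.
- move=> _; have gk k : exists w : vert (c i), g k = vchild _ _ w.
    elim: k => [|k [y gk]]; first by exists u.
    have := edge k; rewrite gk.
    case/glue_edge_child=> [[w gk1 _]|[_ gk1]]; first by exists w.
    by have := loop k.+1; rewrite gk1 /e vpath_unlooped.
  pose w k := sval (cid (gk k)).
  have gw k : g k = vchild _ _ (w k) := svalP (cid (gk k)).
  have [||||||m rmi ml] := IHn (val (val i)) w.
  + exact: leq_trans (ltn_ord _) _.
  + by move=> k; have := loop k; rewrite gw /e glue_edge_limb.
  + by move=> k; have := edge k; rewrite !gw /e glue_edge_limb.
  + by move=> k; apply: contra_neq (g1 k) => wk; rewrite !gw wk.
  + by move=> k; apply: contra_neq (g2 k) => wk; rewrite !gw wk.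
  + by move: gl; rewrite !gw; apply: vchild_inj.
  by exists m => //; apply: r_trans rmi (valP i).
by rewrite /e vpath_unlooped.
Qed.

Lemma cycle_tree_hom_rel a b f :
  li_hom (adj (cycle_tree a)) (adj (cycle_tree b)) f -> r a b.
Proof.
rewrite cycle_treeE in f * => hf; have a3 := girth_gt2 a.
(* The cycle of [a] as an infinite walk, closing up after [girth_of a] steps. *)
pose v k : vert (assemble a cycle_tree) := inl (inl k%:R%R).
have vv k : adj _ (v k) (v k) by rewrite /= /cycle_edge eqxx.
have vS k : adj _ (v k) (v k.+1) by rewrite /= /cycle_edge -natr1 eqxx orbT.
have Sv k : adj _ (v k.+1) (v k) by rewrite /= /cycle_edge -natr1 eqxx !orbT.
have v_inj i j : v i = v j -> (i%:R = j%:R :> 'Z_(girth_of a))%R by case.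
have [|||||m rmb /dvdn_girth ram] := @looped_walk_dvd b (f \o v) (girth_of a).
- by move=> k; apply/hf.1/vv.
- by move=> k; apply/hf.1/vS.
(* The loop makes [v k] its own neighbour, so local injectivity at [v k] separates its image from
   that of [v k.+1]: the image walk cannot stall. *)
- move=> k; apply/eqP => /(li_hom_inj hf (vv k) (vS k))/v_inj/eqP.
  by rewrite -natr1 -subr_eq0 opprD addNKr oppr_eq0 oner_eq0.
- move=> k; apply/eqP => /(li_hom_inj hf (Sv k) (vS k.+1))/v_inj/eqP.
  rewrite -!natr1 -addrA -subr_eq0 opprD addNKr oppr_eq0.
  by rewrite (negPf (Zp_two_neq0 a3)).
- congr (f (inl (inl _))); apply/eqP; rewrite natr_Zp_eq0 //.
by apply: r_trans ram rmb.
Qed.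

End UniversalSequence.

(** * Embedding an arbitrary countable order *)

Lemma countable_ConnGraph : countable [set: ConnGraph]%classic.
Proof.
apply/countable_injP; exists (fun x => pickle (repr x)).
by apply: in2W => x y /(pcan_inj pickleK)/(can_inj reprK).
Qed.

Theorem theorem5p7p14 : universal ConnGraph.
Proof.
split=> [|d' P /countable_injP[code /in2TT code_inj]].
  exact: countable_ConnGraph.
(* The order is carried to the natural numbers along [code]; the disjunct [i = j] makes [r]
   reflexive at numbers that code no element. *)
pose r : rel nat := fun i j =>
  `[< i = j \/ exists a b : P, [/\ code a = i, code b = j & (a <= b)%O] >].
have r_code a b : r (code a) (code b) = (a <= b)%O.
  apply/asboolP/idP => 
    [[/code_inj-> //|[a' [b' [/code_inj-> /code_inj->]]]] //|ab].
  by right; exists a, b.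
have r_refl : reflexive r by move=> i; apply/asboolP; left.
have r_anti : antisymmetric r.
  move=> i j /andP[/asboolP[-> //|[a [b [<- <- ab]]]]].
  by rewrite r_code => ba; congr code; apply/le_anti; rewrite ab.
have r_trans : transitive r.
  move=> j i k /asboolP[-> //|[a [b [<- <- ab]]]].
  move=> /asboolP[<-|[b' [c [/code_inj-> <- bc]]]]; rewrite r_code //.
  exact: le_trans bc.
pose T n := vert (cycle_tree r n).
have ex n : exists (G : cgraph) (f : T n -> vertex G),
    graph_iso (adj _) (edge G) f.
  exact: class_exists (cycle_tree_connected r n).
pose G n := sval (cid (ex n)).
exists (fun a => class (G (code a))) => a b; rewrite class_le -r_code.
have to_G n : exists f : T n -> vertex (G n), li_hom (adj _) (edge (G n)) f.
  have [f [/bij_inj f_inj fe]] := svalP (cid (ex n)).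
  by exists f; apply: li_hom_of_inj => [x y|x y z _ _ /f_inj]; rewrite ?fe.
have of_G n : exists f : vertex (G n) -> T n, li_hom (edge (G n)) (adj _) f.
  have [f [[g fK gK] fe]] := svalP (cid (ex n)).
  exists g; apply: li_hom_of_inj => [x y|x y z _ _ /(can_inj gK)] //.
  by rewrite -fe !gK.
split=> [rab|/asboolP[f hf]].
  have [[g hg] [h hh]] := (of_G (code a), to_G (code b)).
  have [f hf] := cycle_tree_hom r_anti r_trans rab.
  apply/asboolP; exists (h \o (f \o g)).
  exact: li_hom_comp (li_hom_comp hg hf) hh.
have [[g hg] [h hh]] := (to_G (code a), of_G (code b)).
apply: (cycle_tree_hom_rel r_refl r_trans (f := h \o (f \o g))).
exact: li_hom_comp (li_hom_comp hg hf) hh.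
Qed.
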